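(* Let $\{s_n\}_{n\geq 0}$ be a sequence of positive integers such that $\log s_n = \Omega(n)$. Let $p$ be a prime. Assume that $\nu_p(s_n) = O\left(n^C\right)$ for some constant $C < 1$. Then for each fixed positive integer $d$ the equation $$m! = \prod_{i=1}^d s_{n_i}$$ has only a finite number of solutions in positive integers $m, n_1, n_2, \ldots, n_d$.
   Context: For a prime $p$ and a non-zero integer $s$, $\nu_p(s) = \max\{l \geq 0 : p^l \mid s\}$ is the $p$-adic valuation. For sequences $\{a_n\}_{n\geq 0}$, $\{b_n\}_{n \geq 0}$: $a_n = O(b_n)$ means that there is a constant $K>0$ with $|a_n| \leq K|b_n|$ for all sufficiently large $n$; $a_n = \Omega(b_n)$ means that there is a constant $K>0$ with $|a_n| \geq K|b_n|$ for all sufficiently large $n$. *)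

(* Defs.v *)
From HB Require Import structures.
From mathcomp Require Export all_boot all_order all_algebra.
From mathcomp Require Export all_classical all_reals all_analysis.
Export Order.TTheory GRing.Theory Num.Theory.
Export numFieldNormedType.Exports.

Set Implicit Arguments.
Unset Strict Implicit.
Unset Printing Implicit Defensive.

(* Main.v *)
Require Import Defs.
From mathcomp Require Import ring lra.

(** The two hypotheses bound the largest index [n] of a solution in opposite
    directions.

    On the one hand, [m!] is very divisible by [p]: its valuation is at least
    about [m / p] ([ltn_mul_logn_fact]).  Each of the [d] factors [s n_i] has
    valuation [O(n_i ^ C)], hence [O(n ^ C)], so [m = O(n ^ C)].  On the other
    hand, [s n] divides [m!], so the exponential growth of [s] gives
    [n = O(ln m! + 1) = O(m ln m + 1)] ([ln_fact_le]).  Combining the two,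
    [n = O(n ^ C * ln n)], which is impossible for large [n] because [C < 1]
    ([powR_sublinear_bound]).  So [n] is bounded, hence all the [n_i] are, and
    then [m] is too by [m = O(n ^ C)].

    A negative [C] may be replaced by [0], since this only enlarges [n ^ C] for
    positive [n].  The gain is that [n ^ C] is then at least [1] and
    nondecreasing in [n]: finitely many exceptional indices can be absorbed in
    the constant ([eventually_le_global]), and [n_i ^ C] is bounded by
    [n ^ C]. *)

Local Open Scope classical_set_scope.
Local Open Scope ring_scope.

(** Already the first term [m %/ p] of Legendre's formula suffices; the
    successor makes up for the rounding in the division. *)
Lemma ltn_mul_logn_fact (p m : nat) :
  prime p -> (m < p * (logn p m`!).+1)%N.
Proof.
move=> p_prime; case: m => [|m]; first by rewrite muln_gt0 prime_gt0.
rewrite logn_fact // big_ltn // expn1 mulnC.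
apply: (leq_trans (ltn_ceil m.+1 (prime_gt0 p_prime))).
by rewrite leq_mul2r ltnS leq_addr orbT.
Qed.

Lemma leq_fact_exp (n : nat) : (n`! <= n ^ n)%N.
Proof.
elim: n => // n IHn; rewrite factS expnS leq_mul2l /=.
by apply: leq_trans IHn _; case: n => // n; rewrite leq_exp2r.
Qed.

Lemma ln_fact_le (R : realType) (m : nat) :
  ln (m`!%:R : R) <= m%:R * ln (m%:R : R).
Proof.
case: m => [|m]; first by rewrite fact0 ln1 mul0r.
rewrite mulr_natl -lnXn ?ltr0n // -natrX ler_ln ?posrE ?ltr0n ?fact_gt0 ?expn_gt0 //.
by rewrite ler_nat leq_fact_exp.
Qed.

Lemma logn_prod_gt0 (p d : nat) (F : 'I_d -> nat) :
  (forall i, 0 < F i)%N ->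
  logn p (\prod_(i < d) F i) = (\sum_(i < d) logn p (F i))%N.
Proof.
move=> F_gt0.
(* Positivity of the partial products must be carried along, since the
   valuation is additive only on positive numbers. *)
pose K n l := (0 < n)%N /\ logn p n = l.
suff [] : K (\prod_(i < d) F i)%N (\sum_(i < d) logn p (F i))%N by [].
apply: big_ind2 => [|n1 l1 n2 l2 [n1_gt0 <-] [n2_gt0 <-]|i _].
- by split; rewrite ?logn1.
- by split; rewrite ?muln_gt0 ?n1_gt0 // lognM.
- by split.
Qed.

(** This is [ln y < y] at [y = x ^ e]; it makes the logarithm smaller than
    any positive power. *)
Lemma ln_le_powR_div (R : realType) (e x : R) :
  0 < e -> 0 < x -> ln x <= x `^ e / e.
Proof.
move=> e_gt0 x_gt0; rewrite ler_pdivlMr // mulrC -ln_powR.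
by rewrite ltW // ln_sublinear // powR_gt0.
Qed.

Lemma powR_ge1 (R : realType) (x a : R) : 1 <= x -> 0 <= a -> 1 <= x `^ a.
Proof. by move=> x_ge1 a_ge0; rewrite -(powRr0 x) ler_powR. Qed.

(** Substituting the bound on [m] in [m ln m] gives [n = O(n ^ C * ln n)].
    Estimating the logarithm by [n ^ e] with [e = (1 - C) / 2] turns this into
    [n = O(n ^ (C + e))].  Since [C + 2 e = 1], cancelling leaves
    [n ^ e = O(1)]. *)
Lemma powR_sublinear_bound (R : realType) (A B C k : R) :
  1 <= A -> 0 <= B -> 0 <= C < 1 -> 0 < k ->
  exists M : nat, forall n m : nat, (0 < n)%N -> (0 < m)%N ->
    m%:R <= A * n%:R `^ C -> k * n%:R <= m%:R * ln m%:R + B -> (n <= M)%N.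
Proof.
move=> A_ge1 B_ge0 /andP[C_ge0 C_lt1] k_gt0.
pose e : R := (1 - C) / 2; have e_gt0 : 0 < e by rewrite /e; lra.
pose D := A * (A + e^-1) + B.
exists (Num.bound ((D / k) `^ e^-1)) => n m n_gt0 m_gt0 m_le kn_le.
have A_gt0 : 0 < A by lra.
set x : R := n%:R in m_le kn_le.
have x_ge1 : 1 <= x by rewrite ler1n.
have x_gt0 : 0 < x by lra.
have ei_gt0 : 0 < e^-1 by rewrite invr_gt0.
have y_ge1 (a : R) : 0 <= a -> 1 <= x `^ a by exact: powR_ge1.
have ln_m : ln (m%:R : R) <= (A + e^-1) * x `^ e.
  have : ln (m%:R : R) <= ln (A * x).
    rewrite ler_ln ?posrE ?ltr0n ?mulr_gt0 //.
    by apply: (le_trans m_le); rewrite ler_pM2l // ler1_powR // ltW.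
  rewrite lnM ?posrE // => /le_trans; apply.
  have lnA := ln_sublinear A_gt0.
  have lnx := ln_le_powR_div R e x e_gt0 x_gt0.
  have := y_ge1 _ (ltW e_gt0); nra.
have xCe_gt0 : 0 < x `^ (C + e) by rewrite powR_gt0.
have x_split : x = x `^ (C + e) * x `^ e.
  rewrite -powRD; last by rewrite (gt_eqF x_gt0) implybT.
  by rewrite -[LHS]powRr1 ?(ltW x_gt0) //; congr (_ `^ _); rewrite /e; lra.
have kx_le : k * x <= D * x `^ (C + e).
  apply: (le_trans kn_le); rewrite /D mulrDl lerD //.
    have -> : A * (A + e^-1) * x `^ (C + e)
            = (A * x `^ C) * ((A + e^-1) * x `^ e).
      rewrite powRD; last by rewrite (gt_eqF x_gt0) implybT.
      ring.
    by apply: ler_pM => //; rewrite ln_ge0 // ler1n.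
  by rewrite ler_peMr // y_ge1 // addr_ge0 // ltW.
have xe_le : x `^ e <= D / k.
  rewrite ler_pdivlMr // -(ler_pM2r xCe_gt0) (le_trans _ kx_le) //.
  rewrite [X in _ <= k * X]x_split le_eqVlt; apply/orP; left; apply/eqP; ring.
have x_le : x <= (D / k) `^ e^-1.
  rewrite -[x]powRr1 ?(ltW x_gt0) // -(mulfV (lt0r_neq0 e_gt0)) powRrM.
  apply: ge0_ler_powR; rewrite ?nnegrE ?powR_ge0 ?(ltW ei_gt0) //.
  by apply: le_trans xe_le; rewrite powR_ge0.
by rewrite -(ler_nat R) (le_trans x_le) // ltW // archi_boundP // powR_ge0.
Qed.

(** The finitely many indices before the eventual bound sets in are paid for by
    adding [sum |u i|] over them to the constant, which is enough because
    [v >= 1]. *)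
Lemma eventually_le_global (R : realType) (u v : nat -> R) (P : set nat) :
  (forall n, P n -> 1 <= v n) ->
  (exists2 K, 0 < K & \forall n \near \oo, u n <= K * v n) ->
  exists2 K, 0 < K & forall n, P n -> u n <= K * v n.
Proof.
move=> v_ge1 [K K_gt0 [N _ uv]].
have S_ge0 : 0 <= \sum_(i < N) `|u i| by rewrite sumr_ge0.
exists (K + \sum_(i < N) `|u i|); first by lra.
move=> n /v_ge1 vn; have [nN|Nn] := ltnP n N; last first.
  by have := uv n Nn; rewrite /=; nra.
have : `|u n| <= \sum_(i < N) `|u i|.
  by rewrite (bigD1 (Ordinal nN)) //= lerDl sumr_ge0.
have := ler_norm (u n); nra.
Qed.

Lemma finite_set_bounded_tuple (d a b : nat) :
  finite_set [set x : nat * d.-tuple nat |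
    (x.1 <= a)%N /\ forall i, (tnth x.2 i <= b)%N].
Proof.
pose f (y : 'I_a.+1 * d.-tuple 'I_b.+1) : nat * d.-tuple nat :=
  (val y.1, map_tuple val y.2).
apply: (sub_finite_set _ (finite_image f (@finite_finset _ setT))).
move=> [m t] /= [m_le t_le]; exists (inord m, map_tuple inord t) => //.
rewrite /f /= inordK //; congr pair; apply: eq_from_tnth => i.
by rewrite !tnth_map /= inordK // ltnS.
Qed.

Theorem theorem2 (R : realType) (s : nat -> nat) (p : nat) (C : R) (d : nat)
  (s_gt0 : forall n : nat, (0 < s n)%N)
  (log_s : (fun n : nat => ln ((s n)%:R : R) : R^o)
             \is 'Omega_\oo (fun n : nat => (n%:R : R^o)))
  (p_prime : prime p)
  (C_lt1 : C < 1)
  (val_s : (fun n : nat => ((logn p (s n))%:R : R^o))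
             =O_\oo (fun n : nat => ((n%:R : R) `^ C : R^o)))
  (d_gt0 : (0 < d)%N) :
  finite_set [set x : nat * d.-tuple nat |
    [/\ (0 < x.1)%N,
        (forall i : 'I_d, (0 < tnth x.2 i)%N) &
        x.1`! = (\prod_(i < d) s (tnth x.2 i))%N]].
Proof.
pose C' := Num.max C 0.
have C'_bounds : 0 <= C' < 1 by rewrite le_max lexx orbT gt_max C_lt1 ltr01.
have C'_ge0 : 0 <= C' by case/andP: C'_bounds.
have [K K_gt0 val_le] : exists2 K : R, 0 < K &
    forall n, (0 < n)%N -> (logn p (s n))%:R <= K * n%:R `^ C'.
  apply: (@eventually_le_global _ (fun n => (logn p (s n))%:R)
            (fun n => n%:R `^ C') [set n | 0 < n]%N) => [n n_gt0|].
    by rewrite powR_ge1 // ler1n.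
  have /eqO_exP[K K_gt0 val_K] := val_s; exists K => //.
  near=> n; have n_ge1 : 1 <= n%:R :> R.
    by rewrite ler1n; near: n; exists 1%N.
  have := near val_K n; rewrite /= normr_nat ger0_norm ?powR_ge0 // => le.
  apply: le_trans (le _) _ => //.
  by rewrite ler_pM2l // ler_powR // le_max lexx.
have [k k_gt0 [N _ log_ge]] : exists2 k : R, 0 < k &
    \forall n \near \oo, k * n%:R <= ln (s n)%:R.
  move: log_s; rewrite qualifE => /asboolP[k k_gt0 log_k]; exists k => //.
  near=> n; have := near log_k n; rewrite /= normr_nat ger0_norm.
    by apply.
  by rewrite ln_ge0 // ler1n.
(* The shift by [k * N] makes the growth bound valid for every [n], as
   [ln (s n)] is nonnegative. *)
have kn_le n : k * n%:R <= ln (s n)%:R + k * N%:R.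
  have ln_s_ge0 : 0 <= ln ((s n)%:R : R) by rewrite ln_ge0 // ler1n.
  have [nN|Nn] := ltnP n N.
    by rewrite ler_wpDl // ler_pM2l // ler_nat ltnW.
  by rewrite ler_wpDr ?log_ge // mulr_ge0 // ltW.
(* [A] is chosen so that [p (1 + d K n ^ C) <= A n ^ C] when [1 <= n ^ C]. *)
pose A : R := p%:R * (1 + d%:R * K).
have A_ge1 : 1 <= A.
  by rewrite mulr_ege1 ?ler1n ?prime_gt0 // lerDl mulr_ge0 // ltW.
have B_ge0 : 0 <= k * N%:R by rewrite mulr_ge0 // ltW.
have [M M_bound] := powR_sublinear_bound _ _ _ _ _ A_ge1 B_ge0 C'_bounds k_gt0.
apply: sub_finite_set (finite_set_bounded_tuple d (Num.bound (A * M%:R)) M).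
move=> [m t] /= [m_gt0 t_gt0 m_eq].
pose n := tnth t [arg max_(i > Ordinal d_gt0) tnth t i]%N.
have [le_n sn_le] : (forall i, (tnth t i <= n)%N) /\ (s n <= m`!)%N.
  rewrite /n; case: arg_maxnP => //= i _ i_max; split=> [j|]; first exact: i_max.
  by rewrite m_eq dvdn_leq ?prodn_gt0 // (bigD1 i) //= dvdn_mulr.
have n_gt0 : (0 < n)%N by exact: t_gt0.
have m_le : m%:R <= A * n%:R `^ C'.
  have v_le : (logn p m`!)%:R <= d%:R * (K * n%:R `^ C').
    rewrite m_eq logn_prod_gt0 // natr_sum.
    apply: (@le_trans _ _ (\sum_(i < d) K * n%:R `^ C')).
      apply: ler_sum => i _; apply: le_trans (val_le _ (t_gt0 i)) _.
      by rewrite ler_pM2l // ge0_ler_powR // ?nnegrE ?ler_nat.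
    by rewrite sumr_const card_ord mulr_natl.
  have pow_ge1 : 1 <= n%:R `^ C' :> R.
    by rewrite powR_ge1 // ler1n.
  have := ltnW (ltn_mul_logn_fact p m p_prime).
  rewrite -(ler_nat R) natrM -natr1 => /le_trans; apply.
  rewrite /A -mulrA ler_pM2l ?ltr0n ?prime_gt0 //.
  by rewrite mulrDl mul1r addrC lerD // -mulrA.
have n_le : (n <= M)%N.
  apply: (M_bound n m) => //; apply: (le_trans (kn_le n)); rewrite lerD2r.
  apply: le_trans (ln_fact_le R m).
  by rewrite ler_ln ?posrE ?ltr0n ?fact_gt0 // ler_nat.
split=> [|i]; last exact: leq_trans (le_n i) n_le.
rewrite -(ler_nat R) (le_trans m_le) //.
apply: (@le_trans _ _ (A * M%:R)); last first.
  by rewrite ltW // archi_boundP // mulr_ge0 //; lra.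
rewrite ler_pM2l; last by lra.
apply: (@le_trans _ _ n%:R); last by rewrite ler_nat.
by rewrite ler1_powR ?ler1n //; case/andP: C'_bounds => _ /ltW.
Unshelve. all: by end_near. Qed.
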